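(* Let $\lambda>0$ and $f,g\in[-\pi,\pi)^N$, and let $$\mathcal E(x;g,f):=\sum_{j=1}^N\big(d(g_j,x_j)^2+\lambda\,d(f_j,x_j)^2\big),\qquad x\in[-\pi,\pi)^N.$$ Then the minimizer(s) of $\mathcal E(\cdot;g,f)$ over $[-\pi,\pi)^N$ are given by $$\hat x=\Big(\frac{g+\lambda f}{1+\lambda}+\frac{\lambda}{1+\lambda}\,2\pi\,v\Big)_{2\pi},$$ where $v=(v_j)_{j=1}^N\in\mathbb R^N$ is defined by $v_j=0$ if $|g_j-f_j|\le\pi$ and $v_j=\operatorname{sgn}(g_j-f_j)$ if $|g_j-f_j|\ge\pi$ (if $|g_j-f_j|=\pi$, both values of $v_j$ are admissible and both yield minimizers). The minimum is $$\mathcal E(\hat x;g,f)=\frac{\lambda}{1+\lambda}\sum_{j=1}^N\big((g_j-f_j)_{2\pi}\big)^2.$$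
   Context: For $t\in\mathbb R$, $(t)_{2\pi}$ is the unique point of $[-\pi,\pi)$ with $t-(t)_{2\pi}\in2\pi\mathbb Z$; for vectors it is applied componentwise. For $x,y\in[-\pi,\pi)$ (angles representing points of the circle $\mathbb S^1$), $d(x,y)=\min_{k\in\mathbb Z}|y-x+2\pi k|=|(y-x)_{2\pi}|$ is the geodesic distance. $\operatorname{sgn}(t)$ is $1,0,-1$ for $t>0$, $t=0$, $t<0$. *)

(* Defs.v *)
From HB Require Import structures.
From mathcomp Require Import all_boot all_order all_algebra.
From mathcomp Require Import boolp classical_sets reals trigo.
From mathcomp Require Import ring lra.

Set Implicit Arguments.
Unset Strict Implicit.
Unset Printing Implicit Defensive.
Import Order.TTheory GRing.Theory Num.Theory.
Local Open Scope classical_set_scope.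
Local Open Scope ring_scope.

Definition is_angle (R : realType) (t : R) : Prop := - pi <= t < pi.

Definition is_angle_vec (R : realType) (N : nat) (x : 'rV[R]_N) : Prop :=
  forall j : 'I_N, is_angle (x 0 j).

(* (t)_{2 pi}; see [wrap2piP] and [wrap2pi_uniq] for the characterization. *)
Definition wrap2pi (R : realType) (t : R) : R :=
  t - 2 * pi * (Num.floor ((t + pi) / (2 * pi)))%:~R.

(* The infimum is attained, see [circ_dist_min]. *)
Definition circ_dist (R : realType) (x y : R) : R :=
  inf [set `|y - x + 2 * pi * k%:~R| | k in [set: int]].

Definition energy (R : realType) (N : nat) (lambda : R) (g f x : 'rV[R]_N) : R :=
  \sum_(j < N) (circ_dist (g 0 j) (x 0 j) ^+ 2
                + lambda * circ_dist (f 0 j) (x 0 j) ^+ 2).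

Definition is_minimizer (R : realType) (N : nat) (lambda : R)
    (g f x : 'rV[R]_N) : Prop :=
  is_angle_vec x /\
  forall y : 'rV[R]_N, is_angle_vec y ->
    energy lambda g f x <= energy lambda g f y.

(* When |g_j - f_j| = pi both clauses apply and v_j may take either value,
   independently for each j. *)
Definition admissible (R : realType) (N : nat) (g f v : 'rV[R]_N) : Prop :=
  forall j : 'I_N,
    (`|g 0 j - f 0 j| <= pi /\ v 0 j = 0) \/
    (pi <= `|g 0 j - f 0 j| /\ v 0 j = Num.sg (g 0 j - f 0 j)).

Definition xhat (R : realType) (N : nat) (lambda : R) (g f v : 'rV[R]_N) :
    'rV[R]_N :=
  map_mx (@wrap2pi R)
    ((1 + lambda)^-1 *: (g + lambda *: f)
     + (lambda / (1 + lambda) * (2 * pi)) *: v).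

Lemma wrap2piP (R : realType) (t : R) :
  is_angle (wrap2pi t) /\ exists k : int, t - wrap2pi t = 2 * pi * k%:~R.
Proof.
have p0 : 0 < 2 * pi :> R by rewrite mulr_gt0 ?pi_gt0.
split; last by exists (Num.floor ((t + pi) / (2 * pi))); rewrite /wrap2pi; ring.
rewrite /is_angle /wrap2pi; set m := Num.floor _.
have /andP[] := floor_itv ((t + pi) / (2 * pi)); rewrite -/m.
rewrite ler_pdivlMr // ltr_pdivrMr // rmorphD /= => h1 h2.
by apply/andP; split; nra.
Qed.

Lemma wrap2pi_uniq (R : realType) (t s : R) (k : int) :
  is_angle s -> t - s = 2 * pi * k%:~R -> wrap2pi t = s.
Proof.
have p0 : 0 < 2 * pi :> R by rewrite mulr_gt0 ?pi_gt0.
move=> /andP[s1 s2] e; rewrite /wrap2pi.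
have -> : Num.floor ((t + pi) / (2 * pi)) = k.
  apply: floor_def; rewrite ler_pdivlMr // ltr_pdivrMr // rmorphD /=.
  by apply/andP; split; nra.
by rewrite -e; ring.
Qed.

Lemma wrap2pi_le (R : realType) (t : R) (k : int) :
  `|wrap2pi t| <= `|t + 2 * pi * k%:~R|.
Proof.
have [/andP[w1 w2] [m e]] := wrap2piP t.
have p0 := pi_gt0 R.
have -> : t + 2 * pi * k%:~R = wrap2pi t + 2 * pi * (m + k)%:~R.
  by rewrite intrD; lra.
move: (m + k) => n {e}.
have wpi : `|wrap2pi t| <= pi by rewrite ler_norml w1 ltW.
have [n0|n0|->] := ltrgtP n 0; last by rewrite mulr0 addr0.
  have nn : n%:~R <= -1 :> R by rewrite -[-1]/((-1)%:~R) ler_int -ltzD1.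
  apply: (le_trans wpi); rewrite -normrN; apply: le_trans (ler_norm _); nra.
have nn : 1 <= n%:~R :> R by rewrite -[1]/(1%:~R) ler_int.
apply: (le_trans wpi); apply: le_trans (ler_norm _); nra.
Qed.

Lemma circ_distE (R : realType) (x y : R) : circ_dist x y = `|wrap2pi (y - x)|.
Proof.
rewrite /circ_dist; set E := (X in inf X).
have lbE : lbound E `|wrap2pi (y - x)| by move=> _ [k _ <-]; exact: wrap2pi_le.
have Ew : E `|wrap2pi (y - x)|.
  have [_ [m e]] := wrap2piP (y - x).
  by exists (- m) => //; rewrite mulrNz mulrN -e subKr.
apply/eqP; rewrite eq_le; apply/andP; split.
  by apply: ge_inf => //; exists `|wrap2pi (y - x)|.
by apply: lb_le_inf => //; exists `|wrap2pi (y - x)|.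
Qed.

Lemma circ_dist_min (R : realType) (x y : R) :
  (exists k : int, circ_dist x y = `|y - x + 2 * pi * k%:~R|) /\
  (forall k : int, circ_dist x y <= `|y - x + 2 * pi * k%:~R|).
Proof.
rewrite circ_distE; split; last exact: wrap2pi_le.
have [_ [m e]] := wrap2piP (y - x).
by exists (- m); rewrite mulrNz mulrN -e subKr.
Qed.

(* Main.v *)
Require Import Defs.
From mathcomp Require Import all_boot all_order all_algebra.
From mathcomp Require Import boolp classical_sets reals trigo.
From mathcomp Require Import ring lra.
Import Order.TTheory GRing.Theory Num.Theory.
Local Open Scope classical_set_scope.
Local Open Scope ring_scope.

(** The energy is a sum of independent one-coordinate costs
    [d(a,x)^2 + lambda * d(b,x)^2], so everything happens on one circle.
    Choosing lifts that realize both distances, [p] from [a] to [x] and [q]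
    from [b] to [x], the difference [D = q - p] is a lift of [a - b], say
    [D = a - b - 2 pi n] with [n] an integer, and completing the square gives
<<
      p^2 + lambda (p + D)^2
        = (1 + lambda) (p + c D)^2 + c D^2,      c = lambda / (1 + lambda).
>>
    As every lift [D] satisfies [|D| >= |(a - b)_{2 pi}|], the cost is at least
    [c (a - b)_{2 pi}^2] ([pt_cost_ge]).  Equality forces both [p = - c D],
    which determines [x] from [n], and [|D| <= pi]; as [|a - b| < 2 pi], the
    latter leaves exactly the admissible values of [v = n]
    ([pt_admissibleP], [pt_cost_minP]).  Conversely, an admissible value gives
    a point at distances at most [c |D|] from [a] and [|D| / (1 + lambda)]
    from [b], which attains the bound ([pt_cost_xhat]).  A vector is then a
    minimizer iff each of its coordinates attains its own bound. *)

Section OneCoordinate.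
Context {R : realType} (lambda : R).
Hypothesis lambda_gt0 : 0 < lambda.

Definition pt_cost (a b x : R) : R :=
  circ_dist a x ^+ 2 + lambda * circ_dist b x ^+ 2.

Definition pt_admissible (a b v : R) : Prop :=
  (`|a - b| <= pi /\ v = 0) \/ (pi <= `|a - b| /\ v = Num.sg (a - b)).

Definition pt_xhat (a b v : R) : R :=
  wrap2pi ((1 + lambda)^-1 * (a + lambda * b)
           + lambda / (1 + lambda) * (2 * pi) * v).

Lemma norm_wrap2pi_le_pi (t : R) : `|wrap2pi t| <= pi.
Proof. by have [/andP[w1 w2] _] := wrap2piP t; rewrite ler_norml w1 ltW. Qed.

Lemma norm_wrap2pi_shift (t : R) (n : int) :
  `|t - 2 * pi * n%:~R| <= pi -> `|wrap2pi t| = `|t - 2 * pi * n%:~R|.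
Proof.
rewrite ler_norml => /andP[h1]; rewrite le_eqVlt => /predU1P[e|h2].
  (* The lift [pi] is outside the half-open interval: its representative is
     [- pi], of the same norm. *)
  have p0 := pi_gt0 R.
  rewrite e (@wrap2pi_uniq _ t (- pi) (n + 1)) ?normrN //.
    by rewrite /is_angle lexx /=; lra.
  by rewrite rmorphD /=; lra.
rewrite (@wrap2pi_uniq _ t (t - 2 * pi * n%:~R) n) //; last by ring.
by rewrite /is_angle h1 h2.
Qed.

(** The case distinction defining [v] selects the lifts of [a - b] of minimal
    norm: since [|a - b| < 2 pi], at most one turn can be removed, and it must
    be in the direction of [a - b]. *)
Lemma pt_admissibleP (a b v : R) : is_angle a -> is_angle b ->
  pt_admissible a b v <->
    exists2 n : int, v = n%:~R & `|a - b - 2 * pi * n%:~R| <= pi.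
Proof.
move=> /andP[a1 a2] /andP[b1 b2]; have p0 := pi_gt0 R.
split=> [[[h ->]|[h ->]]|[n -> h]].
- by exists 0 => //; rewrite mulr0 subr0.
- have [d0|d0|d0] := ltrgtP (a - b) 0.
  + exists (-1); first by rewrite ltr0_sg // rmorphN1.
    by move: h; rewrite ltr0_norm // rmorphN1 ler_norml; lra.
  + exists 1; first by rewrite gtr0_sg.
    by move: h; rewrite gtr0_norm // ler_norml; lra.
  + by move: h; rewrite d0 normr0; lra.
- move: h; rewrite ler_norml => /andP[h1 h2].
  have [n0|n0|n0] := ltrgtP n 0.
  + have n1 : n%:~R <= -1 :> R by rewrite -[-1]/((-1)%:~R) ler_int -ltzD1.
    have n2 : -2 < n%:~R :> R by nra.
    have -> : n = -1.
      apply/eqP; rewrite eq_le -(ltzD1 n) n0 /= -ltzD1 -ltrBlDr.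
      by rewrite -(ltr_int R) rmorphB /= rmorphN1; lra.
    have d0 : a - b < 0 by nra.
    right; rewrite ltr0_norm // ltr0_sg // rmorphN1; split=> //; nra.
  + have n1 : 1 <= n%:~R :> R by rewrite -[1]/(1%:~R) ler_int.
    have n2 : n%:~R < 2 :> R by nra.
    have -> : n = 1.
      apply/eqP; rewrite eq_le andbC -gtz0_ge1 n0 /= -ltzD1.
      by rewrite -(ltr_int R) rmorphD /=; lra.
    have d0 : 0 < a - b by nra.
    right; rewrite gtr0_norm // gtr0_sg //; split=> //; nra.
  + by left; rewrite ler_norml; move: h1 h2; rewrite n0 mulr0 subr0 => -> ->.
Qed.

Lemma pt_admissible_exists (a b : R) : is_angle a -> is_angle b ->
  exists v, pt_admissible a b v.
Proof.
move=> ha hb; have [_ [n e]] := wrap2piP (a - b).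
exists n%:~R; apply/pt_admissibleP => //; exists n => //.
by rewrite -e subKr norm_wrap2pi_le_pi.
Qed.

(** Completing the square, for the lifts realizing the two distances. *)
Lemma pt_costE (a b x : R) : exists k n : int,
  pt_cost a b x =
    (1 + lambda) * (x - a - 2 * pi * k%:~R
                    + lambda / (1 + lambda) * (a - b - 2 * pi * n%:~R)) ^+ 2
    + lambda / (1 + lambda) * (a - b - 2 * pi * n%:~R) ^+ 2.
Proof.
have [_ [k ek]] := wrap2piP (x - a); have [_ [m em]] := wrap2piP (x - b).
exists k, (m - k); rewrite /pt_cost !circ_distE !real_normK ?num_real //.
have -> : wrap2pi (x - a) = x - a - 2 * pi * k%:~R by rewrite -ek subKr.
have -> : wrap2pi (x - b) = x - b - 2 * pi * m%:~R by rewrite -em subKr.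
by rewrite rmorphB /=; field; rewrite gt_eqF ?addr_gt0.
Qed.

Lemma wrap2pi_sqr_le (t : R) (n : int) :
  wrap2pi t ^+ 2 <= (t - 2 * pi * n%:~R) ^+ 2.
Proof.
have := wrap2pi_le t (- n); rewrite mulrNz mulrN -ler_sqr ?nnegrE //.
by rewrite !real_normK ?num_real.
Qed.

Lemma pt_cost_ge (a b x : R) :
  lambda / (1 + lambda) * wrap2pi (a - b) ^+ 2 <= pt_cost a b x.
Proof.
have [k [n ->]] := pt_costE a b x.
have c0 : 0 < lambda / (1 + lambda) by rewrite divr_gt0 // addr_gt0.
apply: ler_wpDl; first by rewrite mulr_ge0 ?sqr_ge0 // addr_ge0 // ltW.
by rewrite ler_pM2l // wrap2pi_sqr_le.
Qed.

Lemma circ_dist_sqr_le (a x s : R) (k : int) :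
  x - a = s + 2 * pi * k%:~R -> circ_dist a x ^+ 2 <= s ^+ 2.
Proof.
move=> e; rewrite circ_distE real_normK ?num_real //.
by rewrite (le_trans (wrap2pi_sqr_le _ k)) // e addrK.
Qed.

(** Only upper bounds on the two distances are needed, the cost being already
    bounded below by [pt_cost_ge]. *)
Lemma pt_cost_xhat (a b v : R) :
  is_angle a -> is_angle b -> pt_admissible a b v ->
  pt_cost a b (pt_xhat a b v) = lambda / (1 + lambda) * wrap2pi (a - b) ^+ 2.
Proof.
move=> ha hb /pt_admissibleP-/(_ ha hb)[n -> hn].
apply/eqP; rewrite eq_le pt_cost_ge andbT.
have -> : wrap2pi (a - b) ^+ 2 = (a - b - 2 * pi * n%:~R) ^+ 2.
  rewrite -[LHS]real_normK ?num_real // (norm_wrap2pi_shift _ _ hn).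
  by rewrite real_normK ?num_real.
have [_ [k ek]] := wrap2piP ((1 + lambda)^-1 * (a + lambda * b)
           + lambda / (1 + lambda) * (2 * pi) * n%:~R).
rewrite -/(pt_xhat a b n%:~R) in ek.
set x := pt_xhat a b n%:~R in ek *.
have -> : x = (1 + lambda)^-1 * (a + lambda * b)
           + lambda / (1 + lambda) * (2 * pi) * n%:~R - 2 * pi * k%:~R.
  by rewrite -ek subKr.
set D := a - b - 2 * pi * n%:~R.
have -> : lambda / (1 + lambda) * D ^+ 2 =
    (- (lambda / (1 + lambda) * D)) ^+ 2 + lambda * (D / (1 + lambda)) ^+ 2.
  by field; rewrite gt_eqF ?addr_gt0.
apply: lerD; first apply: (@circ_dist_sqr_le _ _ _ (- k)).
  by rewrite rmorphN /= /D; field; rewrite gt_eqF ?addr_gt0.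
rewrite ler_pM2l //; apply: (@circ_dist_sqr_le _ _ _ (n - k)).
by rewrite rmorphB /= /D; field; rewrite gt_eqF ?addr_gt0.
Qed.

(** Equality in the lower bound kills the square in [pt_costE] and makes the
    lift of [a - b] minimal. *)
Lemma pt_cost_minP (a b x : R) :
  is_angle a -> is_angle b -> is_angle x ->
  pt_cost a b x = lambda / (1 + lambda) * wrap2pi (a - b) ^+ 2 ->
  exists v, pt_admissible a b v /\ pt_xhat a b v = x.
Proof.
move=> ha hb hx; have [k [n ->]] := pt_costE a b x.
have := wrap2pi_sqr_le (a - b) n.
set D := a - b - 2 * pi * n%:~R; set q := _ + _ * D => hD e.
have c0 : 0 < lambda / (1 + lambda) by rewrite divr_gt0 // addr_gt0.
have q2 := sqr_ge0 q.
have l0 : 0 <= (1 + lambda) * q ^+ 2 by rewrite mulr_ge0 // addr_ge0 // ltW.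
have eD : D ^+ 2 = wrap2pi (a - b) ^+ 2 by nra.
have /eqP : (1 + lambda) * q ^+ 2 = 0 by rewrite -eD in e; lra.
rewrite mulf_eq0 sqrf_eq0 gt_eqF ?addr_gt0 //= => /eqP q0.
exists n%:~R; split.
  apply/pt_admissibleP => //; exists n => //; rewrite -/D.
  apply: le_trans (norm_wrap2pi_le_pi (a - b)).
  by rewrite -ler_sqr ?nnegrE // !real_normK ?num_real // eD.
apply: (@wrap2pi_uniq _ _ _ (- k)) => //.
have -> : x = a + 2 * pi * k%:~R - lambda / (1 + lambda) * D.
  by move: q0; rewrite /q; lra.
by rewrite rmorphN /= /D; field; rewrite gt_eqF ?addr_gt0.
Qed.

End OneCoordinate.

Lemma xhatE (R : realType) (N : nat) (lambda : R) (g f v : 'rV[R]_N) j :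
  xhat lambda g f v 0 j = pt_xhat lambda (g 0 j) (f 0 j) (v 0 j).
Proof. by rewrite /xhat /pt_xhat !mxE. Qed.

Lemma energy_xhat (R : realType) (N : nat) (lambda : R) (g f v : 'rV[R]_N) :
  0 < lambda -> is_angle_vec g -> is_angle_vec f -> admissible g f v ->
  energy lambda g f (xhat lambda g f v) =
    lambda / (1 + lambda) * \sum_(j < N) wrap2pi (g 0 j - f 0 j) ^+ 2.
Proof.
move=> l0 hg hf hv; rewrite mulr_sumr; apply: eq_bigr => j _.
by rewrite xhatE -(@pt_cost_xhat _ _ l0 _ _ (v 0 j)).
Qed.

Lemma admissible_exists (R : realType) (N : nat) (g f : 'rV[R]_N) :
  is_angle_vec g -> is_angle_vec f -> exists v, admissible g f v.
Proof.
move=> hg hf.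
have [v hv] := choice (fun j => @pt_admissible_exists _ _ _ (hg j) (hf j)).
by exists (\row_j v j) => j; rewrite mxE; exact: hv.
Qed.

Theorem proposition3p7 (R : realType) (N : nat) (lambda : R) (g f : 'rV[R]_N)
    (lambda_gt0 : 0 < lambda) (hg : is_angle_vec g) (hf : is_angle_vec f) :
  [set x : 'rV[R]_N | is_minimizer lambda g f x] =
    [set xhat lambda g f v | v in [set v : 'rV[R]_N | admissible g f v]]
  /\
  (forall v : 'rV[R]_N, admissible g f v ->
     energy lambda g f (xhat lambda g f v) =
       lambda / (1 + lambda) * \sum_(j < N) wrap2pi (g 0 j - f 0 j) ^+ 2).
Proof.
split; last by move=> v; exact: energy_xhat.
apply/seteqP; split=> [x [hx xmin]|_ [v hv <-]] /=; last first.
  split=> [j|y _]; first by rewrite xhatE; exact: (wrap2piP _).1.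
  rewrite energy_xhat // mulr_sumr; apply: ler_sum => j _.
  exact: pt_cost_ge.
have [v0 hv0] := admissible_exists _ _ _ _ hg hf.
have xhat_angle : is_angle_vec (xhat lambda g f v0).
  by move=> j; rewrite xhatE; exact: (wrap2piP _).1.
have := xmin _ xhat_angle; rewrite energy_xhat // mulr_sumr => le_x.
(* The coordinatewise excesses over the bound are nonnegative with a
   nonpositive sum, so they all vanish. *)
pose excess j := pt_cost lambda (g 0 j) (f 0 j) (x 0 j)
  - lambda / (1 + lambda) * wrap2pi (g 0 j - f 0 j) ^+ 2.
have excess_ge0 j : true -> 0 <= excess j by rewrite subr_ge0 pt_cost_ge.
have excess0 : \sum_(j < N) excess j = 0.
  by apply/eqP; rewrite eq_le sumr_ge0 // andbT sumrB subr_le0.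
have cost_x j : exists v, pt_admissible (g 0 j) (f 0 j) v /\
    pt_xhat lambda (g 0 j) (f 0 j) v = x 0 j.
  apply: pt_cost_minP => //; apply/eqP; rewrite -subr_eq0.
  by rewrite -/(excess j) (psumr_eq0P excess_ge0 excess0).
have [v hv] := choice cost_x.
exists (\row_j v j) => [j|]; first by rewrite mxE; exact: (hv j).1.
by apply/rowP => j; rewrite xhatE mxE; exact: (hv j).2.
Qed.
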